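(* Let $\omega=(\omega_1,\omega_2,\dots)$ be a non-constant infinite sequence with entries in $\{0,1,2\}$, and let $G=G_\omega$ be the associated Grigorchuk group acting on the binary rooted tree. Write $\sigma\omega=(\omega_2,\omega_3,\dots)$. Let $$N=\max\{i_0(\sigma\omega),\,i_1(\sigma\omega),\,i_2(\sigma\omega)\}+4$$ (so $N=\infty$ if some $i_k(\sigma\omega)=\infty$), and, if $i_k(\sigma\omega)=\infty$ for exactly one $k\in\{0,1,2\}$, let $$\widetilde N=\max\{i_j(\sigma\omega)\mid j\in\{0,1,2\},\ j\neq k\}+4 .$$ Set $$M=\begin{cases} N & \text{if } N \text{ is finite},\\ \widetilde N & \text{if } N \text{ is infinite and } \sigma\omega \text{ is not a constant sequence},\\ 4 & \text{if } \sigma\omega \text{ is a constant sequence}.\end{cases}$$ Then for every $n\ge M$ the finite $2$-group $G/\mathrm{St}_G(n)$ is not semi-$2^{e-1}$-abelian, where $2^e$ is the exponent of $G/\mathrm{St}_G(n)$.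
   Context: **Tree.** Let $\mathcal T$ be the binary rooted tree, whose vertices are identified with the finite words over $X=\{0,1\}$: the root is the empty word, and each word $\nu$ is joined to $\nu0$ and $\nu1$. Automorphisms of $\mathcal T$ fix the root and act on the right. The $n$th level consists of the words of length $n$. For $G\le\mathrm{Aut}(\mathcal T)$, $\mathrm{St}_G(n)$ is the (normal) subgroup of elements of $G$ fixing every vertex at level $n$. The natural isomorphism $\psi:\mathrm{St}_{\mathrm{Aut}(\mathcal T)}(1)\to \mathrm{Aut}(\mathcal T)\times\mathrm{Aut}(\mathcal T)$ sends an automorphism to its pair of restrictions to the subtrees rooted at the vertices $0$ and $1$ (each subtree identified with $\mathcal T$ by deleting the first letter). **Grigorchuk groups.** For an infinite sequence $\omega=(\omega_1,\omega_2,\dots)$ in $\{0,1,2\}$, put $\sigma\omega=(\omega_2,\omega_3,\dots)$. Let $a$ be the automorphism swapping the two maximal subtrees (i.e. changing the first letter of each nonempty word and nothing else), and let $1$ denote the identity. Define $b_\omega,c_\omega,d_\omega\in\mathrm{St}_{\mathrm{Aut}(\mathcal T)}(1)$ recursively by $\psi(b_\omega)=(\beta,b_{\sigma\omega})$, $\psi(c_\omega)=(\gamma,c_{\sigma\omega})$, $\psi(d_\omega)=(\delta,d_{\sigma\omega})$, where $\beta=1$ if $\omega_1=2$ and $\beta=a$ otherwise; $\gamma=1$ if $\omega_1=1$ and $\gamma=a$ otherwise; $\delta=1$ if $\omega_1=0$ and $\delta=a$ otherwise. The Grigorchuk group is $G_\omega=\langle a,b_\omega,c_\omega,d_\omega\rangle$.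 **The numbers $i_k$.** For $k\in\{0,1,2\}$, $i_k(\omega)=\min\{n\in\mathbb N\mid \omega_n=k\}$ (with $\mathbb N=\{1,2,\dots\}$) if the minimum exists, and $i_k(\omega)=\infty$ otherwise; $i_k(\sigma\omega)$ is this quantity for the sequence $\sigma\omega$, with its entries indexed starting from $1$. **Semi-abelian condition.** A finite $p$-group $H$ of exponent $p^e$ is semi-$p^{e-1}$-abelian if for all $x,y\in H$: $x^{p^{e-1}}=y^{p^{e-1}}$ if and only if $(xy^{-1})^{p^{e-1}}=1$. *)

(* Defs.v *)
From HB Require Import structures.
From mathcomp Require Import all_boot all_fingroup all_solvable boolp zify.

Set Implicit Arguments.
Unset Strict Implicit.
Unset Printing Implicit Defensive.

Local Open Scope group_scope.

(* The letters 0 and 1 are [false] and [true]; a word is read from the root,  *)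
(* so its first letter is the head of the list.                               *)
Definition word := seq bool.

Definition child (u v : word) : Prop := exists x, v = rcons u x.

Definition adj (u v : word) : Prop := child u v \/ child v u.

(* The inverse is part of the data, as it cannot be extracted from a proof of *)
(* [bijective] without choice; it is determined by [aut_fun] (see [aut_ext]). *)
Record tree_aut := TreeAut {
  aut_fun :> word -> word;
  aut_inv : word -> word;
  aut_funK : cancel aut_fun aut_inv;
  aut_invK : cancel aut_inv aut_fun;
  aut_root : aut_fun [::] = [::];
  aut_adj : forall u v, adj (aut_fun u) (aut_fun v) <-> adj u v }.

Lemma aut_ext (g h : tree_aut) : g =1 h -> g = h.
Proof.
case: g h => [f f' fK f'K fr fa] [k k' kK k'K kr ka] /= /funext fk.
subst k.
have ff' : f' = k' by apply/funext => v; rewrite -{1}(k'K v) fK.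
subst k'.
by congr TreeAut; apply: Prop_irrelevance.
Qed.

Definition aut_one : tree_aut :=
  @TreeAut id id (frefl id) (frefl id) erefl (fun _ _ => iff_refl _).

Fact aut_mul_adj (g h : tree_aut) u v : adj (h (g u)) (h (g v)) <-> adj u v.
Proof. exact: iff_trans (aut_adj h _ _) (aut_adj g _ _). Qed.

(* Automorphisms act on the right: the product g h is g followed by h. *)
Definition aut_mul (g h : tree_aut) : tree_aut :=
  @TreeAut (h \o g) (aut_inv g \o aut_inv h)
    (can_comp (aut_funK h) (aut_funK g)) (can_comp (aut_invK g) (aut_invK h))
    (etrans (congr1 h (aut_root g)) (aut_root h)) (aut_mul_adj g h).

Fact aut_inv_root (g : tree_aut) : aut_inv g [::] = [::].
Proof. by have := aut_funK g [::]; rewrite aut_root. Qed.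

Fact aut_inv_adj (g : tree_aut) u v :
  adj (aut_inv g u) (aut_inv g v) <-> adj u v.
Proof.
by apply: iff_sym; have := aut_adj g (aut_inv g u) (aut_inv g v); rewrite !aut_invK.
Qed.

Definition aut_invg (g : tree_aut) : tree_aut :=
  @TreeAut (aut_inv g) g (aut_invK g) (aut_funK g)
    (aut_inv_root g) (aut_inv_adj g).

Fact aut_mulA : associative aut_mul.
Proof. by move=> f g h; apply: aut_ext. Qed.
Fact aut_mul1 : left_id aut_one aut_mul.
Proof. by move=> g; apply: aut_ext. Qed.
Fact aut_mulg1 : right_id aut_one aut_mul.
Proof. by move=> g; apply: aut_ext. Qed.
Fact aut_mulV : left_inverse aut_one aut_invg aut_mul.
Proof. by move=> g; apply: aut_ext => v; apply: aut_invK. Qed.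
Fact aut_mulgV : right_inverse aut_one aut_invg aut_mul.
Proof. by move=> g; apply: aut_ext => v; apply: aut_funK. Qed.

HB.instance Definition _ := gen_eqMixin tree_aut.
HB.instance Definition _ := gen_choiceMixin tree_aut.
HB.instance Definition _ :=
  isGroup.Build tree_aut aut_mulA aut_mul1 aut_mulg1 aut_mulV aut_mulgV.

Lemma aut_child (g : tree_aut) u x : exists y, g (rcons u x) = rcons (g u) y.
Proof.
elim/last_ind: u x => [|u z IHu] x.
  have [//|[y]] : adj (g [::]) (g [:: x]) by apply/aut_adj; left; exists x.
  by rewrite aut_root; case: (g _).
have [//|[y]] : adj (g (rcons u z)) (g (rcons (rcons u z) x)).
  by apply/aut_adj; left; exists x.
have [t ->] := IHu z; move=> /rcons_inj[] /(can_inj (aut_funK g)) /(congr1 size).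
by rewrite !size_rcons => /eqP; rewrite -addn2 -{1}[size u]addn0 eqn_add2l.
Qed.

Lemma aut_size (g : tree_aut) v : size (g v) = size v.
Proof.
elim/last_ind: v => [|u x IHu]; first by rewrite aut_root.
by have [y ->] := aut_child g u x; rewrite !size_rcons IHu.
Qed.

Definition child_hom (f : word -> word) : Prop :=
  f [::] = [::] /\ forall u x, exists y, f (rcons u x) = rcons (f u) y.

Fact child_hom_adj f f' : cancel f f' -> child_hom f -> child_hom f' ->
  forall u v, adj (f u) (f v) <-> adj u v.
Proof.
move=> fK [_ hf] [_ hf'].
have hom k p q : (forall u x, exists y, k (rcons u x) = rcons (k u) y) ->
    adj p q -> adj (k p) (k q).
  move=> hk [] [x ->]; [have [y ->] := hk p x | have [y ->] := hk q x].
    by left; exists y.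
  by right; exists y.
move=> u v; split=> uv; last exact: hom.
by rewrite -(fK u) -(fK v); apply: hom.
Qed.

Definition mk_aut f f' (fK : cancel f f') (f'K : cancel f' f)
    (hf : child_hom f) (hf' : child_hom f') : tree_aut :=
  @TreeAut f f' fK f'K (proj1 hf) (child_hom_adj fK hf hf').

Definition a_fun (v : word) : word :=
  if v is x :: u then ~~ x :: u else [::].

Fact a_funK : involutive a_fun.
Proof. by case=> [|x u] //=; rewrite negbK. Qed.

Fact a_fun_hom : child_hom a_fun.
Proof. by split=> // -[|z u] x; [exists (~~ x) | exists x]. Qed.

Definition aut_a : tree_aut := mk_aut a_funK a_funK a_fun_hom a_fun_hom.

(* A sequence is indexed from 0 here: the entry omega_n is [w n.-1], n >= 1.  *)
Definition tseq := nat -> 'I_3.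

Definition shift (w : tseq) : tseq := fun n => w n.+1.

(* psi of the automorphism is (1 or a, same automorphism for [shift w]), the  *)
(* first component being 1 exactly when omega_1 = k; see [aut_dirE].          *)
Fixpoint dir_fun (k : nat) (w : tseq) (v : word) : word :=
  match v with
  | [::] => [::]
  | false :: u => false :: (if w 0 == k :> nat then u else a_fun u)
  | true :: u => true :: dir_fun k (shift w) u
  end.

Fact dir_funK k w : involutive (dir_fun k w).
Proof.
move=> v; elim: v w => [|[] u IHu] w //=; first by rewrite IHu.
by case: (_ == k); rewrite ?a_funK.
Qed.

Fact dir_fun_hom k w : child_hom (dir_fun k w).
Proof.
split=> // u; elim: u w => [|[] u IHu] w x /=.
- by case: x => /=; [exists true | case: ifP; exists false].
- by have [y ->] := IHu (shift w) x; exists y.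
case: ifP => _; first by exists x.
by have [y ->] := proj2 a_fun_hom u x; exists y.
Qed.

Definition aut_dir k w : tree_aut :=
  mk_aut (@dir_funK k w) (@dir_funK k w) (dir_fun_hom k w) (dir_fun_hom k w).

Definition aut_b := aut_dir 2.
Definition aut_c := aut_dir 1.
Definition aut_d := aut_dir 0.

(* [psi_inv g h] is the inverse image of (g, h) under the isomorphism psi     *)
(* defined on the first level stabilizer of the full automorphism group.      *)
Definition psi_inv_fun (g h : word -> word) (v : word) : word :=
  match v with
  | [::] => [::]
  | false :: u => false :: g u
  | true :: u => true :: h u
  end.

Fact psi_inv_funK g g' h h' : cancel g g' -> cancel h h' ->
  cancel (psi_inv_fun g h) (psi_inv_fun g' h').
Proof. by move=> gK hK [|[] u] //=; rewrite ?gK ?hK. Qed.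

Fact psi_inv_fun_hom (g h : tree_aut) : child_hom (psi_inv_fun g h).
Proof.
split=> // -[|[] u] x /=; first by case: x; rewrite /= aut_root; eexists.
  by have [y ->] := aut_child h u x; exists y.
by have [y ->] := aut_child g u x; exists y.
Qed.

Definition psi_inv (g h : tree_aut) : tree_aut :=
  mk_aut (psi_inv_funK (aut_funK g) (aut_funK h))
    (psi_inv_funK (aut_invK g) (aut_invK h))
    (psi_inv_fun_hom g h) (psi_inv_fun_hom g^-1 h^-1).

Lemma aut_dirE k w :
  aut_dir k w =
  psi_inv (if w 0 == k :> nat then 1 else aut_a) (aut_dir k (shift w)).
Proof. by apply: aut_ext => -[|[] u] //=; case: ifP. Qed.

Inductive generated (gT : groupType) (S : gT -> Prop) : gT -> Prop :=
  | gen_in x : S x -> generated S x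
  | gen_1 : generated S 1
  | gen_M x y : generated S x -> generated S y -> generated S (x * y)
  | gen_V x : generated S x -> generated S x^-1.

Definition grig_pred (w : tseq) : {pred tree_aut} :=
  fun g => `[< generated
    (fun s => s \in [:: aut_a; aut_b w; aut_c w; aut_d w]) g >].

Fact grig_group_closed w : group_closed (grig_pred w).
Proof.
split=> [|g h]; first by apply/asboolP/gen_1.
move=> /asboolP gG /asboolP hG; apply/asboolP.
by apply: gen_M => //; apply: gen_V.
Qed.

Definition grig (w : tseq) := {g : tree_aut | g \in grig_pred w}.

HB.instance Definition _ w := SubChoice.on (grig w).
HB.instance Definition _ w := SubChoice_isSubGroup.Build tree_aut (grig_pred w)
  (grig w) (@grig_group_closed w).

Definition level_stab (w : tseq) (n : nat) : {pred grig w} :=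
  fun g => `[< forall v : word, size v = n -> val g v = v >].
Arguments level_stab : clear implicits.

Definition stab_rel (w : tseq) (n : nat) : rel (grig w) :=
  fun g h => g^-1 * h \in level_stab w n.

Lemma stab_relP w n (g h : grig w) :
  reflect (forall v : word, size v = n -> val g v = val h v) (stab_rel n g h).
Proof.
apply: (iffP (asboolP _)) => gh v vn.
  have := gh (val g v); rewrite aut_size => /(_ vn) <-.
  by rewrite gmulfM gmulfV /= aut_funK.
rewrite gmulfM gmulfV /= -gh ?aut_invK //.
by rewrite -(aut_size (val g)) aut_invK.
Qed.

Fact stab_rel_equiv w n : equiv_class_of (@stab_rel w n).
Proof.
split=> [g|g h|h g k].
- exact/stab_relP.
- by apply/stab_relP/stab_relP => gh v /gh.
- by move=> /stab_relP gh /stab_relP hk; apply/stab_relP => v vn; rewrite gh ?hk.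
Qed.

Canonical stab_equiv w n := EquivRelPack (stab_rel_equiv w n).

(* [grig_quo w n] is the quotient of [grig w] by [level_stab w n]: [quo_pi n] *)
(* is onto by construction, and multiplicative with kernel [level_stab w n]   *)
(* by [quo_piM] and [quo_piP]; finiteness comes from the action on level n.   *)
Definition grig_quo (w : tseq) (n : nat) := {eq_quot stab_equiv w n}%qT.

HB.instance Definition _ w n := EqQuotient.on (grig_quo w n).
HB.instance Definition _ w n := Choice.on (grig_quo w n).

Definition quo_pi (w : tseq) (n : nat) (g : grig w) : grig_quo w n :=
  (\pi_(grig_quo w n) g)%qT.

Lemma quo_piP w n (g h : grig w) :
  (quo_pi n g = quo_pi n h) <-> (g^-1 * h \in level_stab w n).
Proof. by split=> [/eqP|gh]; [|apply/eqP]; rewrite eqmodE. Qed.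

Definition quo_act (w : tseq) (n : nat) (x : grig_quo w n) :
    {ffun n.-tuple bool -> n.-tuple bool} :=
  [ffun t : n.-tuple bool => insubd t (val (generic_quotient.repr x) t)].

Fact quo_act_inj w n : injective (@quo_act w n).
Proof.
move=> x y /ffunP xy; rewrite -(reprK x) -(reprK y).
apply/quo_piP/stab_relP => v /eqP vn; have := xy (Tuple vn).
by rewrite !ffunE => /(congr1 val); rewrite !val_insubd !aut_size vn.
Qed.

Definition quo_unact w n y : option (grig_quo w n) :=
  if pselect (exists x, quo_act x = y) is left xy then Some (projT1 (cid xy))
  else None.

Fact quo_actK w n : pcancel (@quo_act w n) (@quo_unact w n).
Proof.
move=> x; rewrite /quo_unact; case: pselect => [xy|[]]; last by exists x.
by congr Some; apply: quo_act_inj; case: (cid xy).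
Qed.

HB.instance Definition _ w n : isCountable (grig_quo w n) :=
  PCanIsCountable (@quo_actK w n).
HB.instance Definition _ w n : isFinite (grig_quo w n) :=
  PCanIsFinite (@quo_actK w n).

Definition quo_mul w n (x y : grig_quo w n) : grig_quo w n :=
  quo_pi n (generic_quotient.repr x * generic_quotient.repr y).

Definition quo_inv w n (x : grig_quo w n) : grig_quo w n :=
  quo_pi n (generic_quotient.repr x)^-1.

Fact quo_repr w n (g : grig w) v : size v = n ->
  val (generic_quotient.repr (quo_pi n g)) v = val g v.
Proof.
by apply/stab_relP/quo_piP; rewrite /quo_pi reprK.
Qed.

Fact quo_mul_pi w n (g h : grig w) :
  quo_pi n (g * h) = quo_mul (quo_pi n g) (quo_pi n h).
Proof.
apply/quo_piP/stab_relP => v vn; rewrite !gmulfM /= !quo_repr //.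
by rewrite aut_size.
Qed.

Fact quo_pi_surj w n (x : grig_quo w n) : exists g, x = quo_pi n g.
Proof. by exists (generic_quotient.repr x); rewrite /quo_pi reprK. Qed.

Fact quo_mulA w n : associative (@quo_mul w n).
Proof.
move=> x y z; have [f ->] := quo_pi_surj x; have [g ->] := quo_pi_surj y.
by have [h ->] := quo_pi_surj z; rewrite -!quo_mul_pi mulgA.
Qed.

Fact quo_mul1 w n : left_id (quo_pi n 1) (@quo_mul w n).
Proof. by move=> x; have [g ->] := quo_pi_surj x; rewrite -quo_mul_pi mul1g. Qed.

Fact quo_mulV w n : left_inverse (quo_pi n 1) (@quo_inv w n) (@quo_mul w n).
Proof.
move=> x; rewrite -[X in quo_mul _ X](reprK x) -[LHS]quo_mul_pi.
by rewrite mulVg.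
Qed.

HB.instance Definition _ w n := Finite_isGroup.Build (grig_quo w n)
  (@quo_mulA w n) (@quo_mul1 w n) (@quo_mulV w n).

Lemma quo_piM w n : {morph @quo_pi w n : g h / g * h}.
Proof. exact: quo_mul_pi. Qed.

Definition const_seq (w : tseq) : Prop := forall m n, w m = w n.

(* [None] stands for infinity in the following extended natural numbers. *)
Definition oaddn (m : nat) (x : option nat) : option nat := omap (addn m) x.

Definition omax (x y : option nat) : option nat :=
  if x is Some m then (if y is Some n then Some (maxn m n) else None) else None.

Definition first_occ (k : 'I_3) (w : tseq) : option nat :=
  if pselect (exists n, (0 < n) && (w n.-1 == k)) is left ex
  then Some (ex_minn ex) else None.

Definition boundN (w : tseq) : option nat :=
  oaddn 4 (\big[omax/Some 0]_(k < 3) first_occ k (shift w)).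

Definition boundNt (w : tseq) : option nat :=
  if [pick k | first_occ k (shift w) == None] is Some k
  then oaddn 4 (\big[omax/Some 0]_(j < 3 | j != k) first_occ j (shift w))
  else None.

(* The second branch is reached only when exactly one [first_occ k (shift w)] *)
(* is infinite, so [boundM] is always finite; see [boundM_finite].            *)
Definition boundM (w : tseq) : option nat :=
  if boundN w is Some N then Some N
  else if ~~ `[< const_seq (shift w) >] then boundNt w
  else Some 4.

Fact first_occ_None k w : (first_occ k w == None) = `[< forall n, w n != k >].
Proof.
rewrite /first_occ; case: pselect => [ex|no] /=.
  have [n /andP[n0 wn]] := ex.
  by apply/esym/negbTE/negP => /asboolP/(_ n.-1); rewrite wn.
by apply/esym/asboolP => n; apply/negP => wn; apply: no; exists n.+1.
Qed.

Fact big_omax_Some (P : pred 'I_3) F :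
  (forall k, P k -> F k != None) -> \big[omax/Some 0]_(k < 3 | P k) F k != None.
Proof. by move=> FP; elim/big_ind: _ => // -[m|] // [n|]. Qed.

Lemma boundM_finite w : exists M, boundM w = Some M.
Proof.
suff: boundM w != None by case: (boundM w) => // M _; exists M.
rewrite /boundM; case N0: (boundN w) => [//|]; rewrite /boundN in N0.
have [//|nc] /= := asboolP; rewrite /boundNt; case: pickP => [k|fin]; last first.
  have := @big_omax_Some predT (first_occ^~ (shift w)) (fun k _ => negbT (fin k)).
  by case: (bigop.body _ _ _) N0.
rewrite first_occ_None => /asboolP nk.
suff: \big[omax/Some 0]_(j < 3 | j != k) first_occ j (shift w) != None.
  by case: (bigop.body _ _ _).
apply: big_omax_Some => j jk.
rewrite first_occ_None; apply/asboolP => nj; apply: nc => m n.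
move: (shift w m) (shift w n) (nk m) (nk n) (nj m) (nj n) jk => x y.
rewrite -!val_eqE /= => *; apply/val_inj => /=.
have := (ltn_ord j, ltn_ord k); have := (ltn_ord x, ltn_ord y) => -[x3 y3] [j3 k3].
lia.
Qed.

(* Meant for H a p-group of exponent p ^ e with 0 < e; for e = 0 the power    *)
(* p ^ e.-1 is 1 and the condition always holds.                              *)
Definition semi_abelian (p e : nat) (gT : finGroupType) (H : {group gT}) : Prop :=
  forall x y, x \in H -> y \in H ->
    x ^+ (p ^ e.-1) = y ^+ (p ^ e.-1) <-> (x * y^-1) ^+ (p ^ e.-1) = 1.

(* Main.v *)
Require Import Defs.
From mathcomp Require Import all_boot all_fingroup all_solvable boolp zify.

Set Implicit Arguments.
Unset Strict Implicit.
Unset Printing Implicit Defensive.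

(** Write G_n for the quotient of the Grigorchuk group by the stabilizer of
    level n, and 2 ^ e for its exponent.  Semi-abelianness, applied to x and
    y^-1, makes the elements killed by 2 ^ (e - 1) a subgroup
    ([semi_abelian_group_set]).  The generators a, b, c, d of G_n are
    involutions, so if e >= 2 this subgroup contains them and is all of G_n;
    then the exponent divides 2 ^ (e - 1), a contradiction
    ([gen_not_semi_abelian]).

    It remains to see that e >= 2, that is, that some square is nontrivial in
    G_n.  At least one of b and c has first component a, because the first
    letter of the sequence cannot be both 2 and 1; if x is that generator, the
    square of a x changes the second letter of a word
    ([quo_aM_dir_sqr_neq1]), and n >= 4 by [boundM_ge4].

    Finally G_n is a 2-group because the action on any binary tree is: if g
    fixes level n, then its square fixes level n + 1, since g can only exchange
    the two children of a vertex of level n ([aut_expg_fix]). *)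

Local Open Scope group_scope.

(** A product x y is x (y^-1)^-1, and x and y^-1 have the same power, namely 1,
    so one direction of the condition gives closure under products. *)
Lemma semi_abelian_group_set (p e : nat) (gT : finGroupType) (H : {group gT}) :
  semi_abelian p e H -> group_set [set x in H | x ^+ (p ^ e.-1) == 1].
Proof.
move=> sH; apply/group_setP; split=> [|x y].
  by rewrite inE group1 expg1n eqxx.
rewrite !inE => /andP[xH /eqP xq] /andP[yH /eqP yq]; rewrite groupM //=.
have [+ _] := sH x y^-1 xH (groupVr yH).
by rewrite invgK expgVn xq yq invg1 => ->.
Qed.

(** The elements killed by p ^ (e - 1) would form a subgroup, and it is proper
    by the value of the exponent, so they cannot generate. *)
Lemma gen_not_semi_abelian (p e : nat) (gT : finGroupType) (H : {group gT}) :
  (1 < p)%N -> (0 < e)%N -> exponent H = (p ^ e)%N ->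
  H \subset <<[set x in H | x ^+ (p ^ e.-1) == 1]>> -> ~ semi_abelian p e H.
Proof.
move=> p1 e0 expH sHK /semi_abelian_group_set gK.
have : exponent H %| p ^ e.-1.
  apply/exponentP => x /(subsetP sHK).
  by rewrite (gen_set_id gK) inE => /andP[_ /eqP].
by rewrite expH dvdn_Pexp2l // leqNgt ltn_predL e0.
Qed.

Lemma aut_expgE (g : tree_aut) k v : (g ^+ k) v = iter k g v.
Proof. by elim: k v => [|k IHk] v //; rewrite expgS iterSr -IHk. Qed.

(** If h fixes the parent u, it permutes the two children of u, and the square
    of a permutation of two points is trivial. *)
Lemma aut_expg_fix (g : tree_aut) n v : size v = n -> (g ^+ (2 ^ n)) v = v.
Proof.
elim: n v => [|n IHn] v; first by move=> /size0nil ->; rewrite aut_root.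
case/lastP: v => // u x; rewrite size_rcons => -[un].
rewrite expnS mulnC expgM; set h := g ^+ (2 ^ n).
have hu y : exists z, h (rcons u y) = rcons u z.
  by have [z] := aut_child h u y; rewrite /h (IHn u un) => hz; exists z.
rewrite aut_expgE /=.
have [y hx] := hu x; rewrite hx; have [z hy] := hu y; rewrite hy.
have inj := can_inj (aut_funK h).
case: (eqVneq y x) => [yx|yx].
  by move: hy; rewrite yx hx => <-; rewrite yx.
have zy : z <> y.
  move=> zy; move: hy; rewrite zy -hx => /inj; rewrite hx => /rcons_inj[] /eqP.
  by rewrite (negPf yx).
by move: zy yx; case: (x) (y) (z) => -[] [].
Qed.

Lemma quo_piX (w : tseq) n (g : grig w) k : quo_pi n (g ^+ k) = quo_pi n g ^+ k.
Proof. by elim: k => [|k IHk] //; rewrite !expgS quo_piM IHk. Qed.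

Lemma quo_pi_eq1P (w : tseq) n (g : grig w) :
  quo_pi n g = 1 <-> forall v, size v = n -> val g v = v.
Proof.
split=> [g1 v vn|fix_g].
  have /quo_piP/stab_relP/(_ v vn) := esym g1.
  by rewrite gmulf1 => <-.
by apply/esym/quo_piP/stab_relP => v /fix_g ->; rewrite gmulf1.
Qed.

Lemma grig_quo_pgroup (w : tseq) n : 2.-group [set: grig_quo w n].
Proof.
rewrite -pnat_exponent; apply: (@pnat_dvd _ (2 ^ n)); last first.
  by rewrite pnatX pnat_id.
apply/exponentP => x _; have [g ->] := quo_pi_surj x.
rewrite -quo_piX; apply/quo_pi_eq1P => v vn.
by rewrite gmulfXn aut_expg_fix.
Qed.

Definition grig_gens (w : tseq) := [:: aut_a; aut_b w; aut_c w; aut_d w].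

Lemma grig_gens_sub (w : tseq) s : s \in grig_gens w -> s \in grig_pred w.
Proof. by move=> sw; apply/asboolP/gen_in. Qed.

Lemma grig_gens_sqr (w : tseq) s : s \in grig_gens w -> s ^+ 2 = 1.
Proof.
rewrite !inE; case/or4P=> /eqP ->; apply: aut_ext => v; rewrite aut_expgE /=.
- exact: a_funK.
- exact: dir_funK.
- exact: dir_funK.
- exact: dir_funK.
Qed.

(** Reduces a statement on the whole quotient to the four generators. *)
Lemma grig_quo_gen (w : tseq) n (K : {group grig_quo w n}) :
  (forall g : grig w, val g \in grig_gens w -> quo_pi n g \in K) ->
  K :=: [set: grig_quo w n].
Proof.
move=> genK; apply/setP => x; rewrite in_setT.
have [g ->] := quo_pi_surj x.
have /asboolP : val g \in grig_pred w := valP g.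
(* The induction runs over tree automorphisms; each intermediate one lies in
   the Grigorchuk group, so it has a class in the quotient. *)
move gt: (val g) => t tG; elim: tG g gt => [s sS|||] {x t}.
- by move=> g gs; apply: genK; rewrite gs.
- move=> g g1; have -> : quo_pi n g = 1 by apply/quo_pi_eq1P => v _; rewrite g1.
  exact: group1.
- move=> s t sG IHs tG IHt g gst.
  have sP : s \in grig_pred w by apply/asboolP.
  have tP : t \in grig_pred w by apply/asboolP.
  have -> : g = Sub s sP * Sub t tP.
    by apply: val_inj; rewrite gmulfM /= gst.
  by rewrite quo_piM groupM ?(IHs (Sub s sP)) ?(IHt (Sub t tP)).
move=> s sG IHs g gs; rewrite -groupV.
have -> : (quo_pi n g)^-1 = quo_pi n g^-1.
  apply/eqP; rewrite eq_invg_mul -quo_piM mulgV; exact/eqP.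
by apply: IHs; rewrite gmulfV /= gs invgK.
Qed.

(** As the first letter of the sequence is not k, the directed generator x has
    first component a.  Acting on the right, a x sends 00... to 10... (x acts
    below 1 through a directed generator, which keeps the next letter) and then
    to 01... (x acts below 0 through a), so its square is not the identity on
    level 2. *)
Lemma quo_aM_dir_sqr_neq1 (w : tseq) n (k : nat) (g : grig w) :
  (1 < n)%N -> w 0 != k :> nat -> val g = aut_a * aut_dir k w ->
  quo_pi n g ^+ 2 != 1.
Proof.
move=> n1 wk gE; rewrite -quo_piX; apply/eqP => /quo_pi_eq1P.
move=> /(_ [:: false, false & nseq (n - 2) false]).
by rewrite gmulfXn aut_expgE /= gE /= (negPf wk) size_nseq => /(_ ltac:(lia)).
Qed.

Lemma grig_quo_sqr_neq1 (w : tseq) n :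
  (1 < n)%N -> exists x : grig_quo w n, x ^+ 2 != 1.
Proof.
move=> n1.
have [k wk kG] : exists2 k : nat, w 0 != k :> nat & aut_dir k w \in grig_gens w.
  case: (eqVneq (w 0 : nat) 2) => [w2|]; last first.
    by exists 2%N; rewrite // !inE eqxx orbT.
  by exists 1%N; rewrite ?w2 // !inE eqxx !orbT.
have aG : aut_a \in grig_gens w by rewrite mem_head.
pose a : grig w := Sub aut_a (grig_gens_sub aG).
pose b : grig w := Sub (aut_dir k w) (grig_gens_sub kG).
exists (quo_pi n (a * b)).
by apply: (quo_aM_dir_sqr_neq1 n1 wk); rewrite gmulfM.
Qed.

Lemma boundM_ge4 (w : tseq) M : boundM w = Some M -> (4 <= M)%N.
Proof.
have add4 x : oaddn 4 x = Some M -> (4 <= M)%N.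
  by case: x => //= m [<-]; rewrite leq_addr.
rewrite /boundM; case N: (boundN w) => [m|].
  by move=> [mM]; apply: add4; rewrite -mM; exact: N.
case: ifP => [_|_ [<-] //].
by rewrite /boundNt; case: pickP => // k _; apply: add4.
Qed.

Theorem corollary2 (w : tseq) (M : nat) (n : nat) :
  ~ const_seq w ->
  boundM w = Some M ->
  (M <= n)%N ->
  2.-group [set: grig_quo w n] /\
  forall e : nat, exponent [set: grig_quo w n] = (2 ^ e)%N ->
    ~ semi_abelian 2 e [set: grig_quo w n]%G.
Proof.
move=> _ /boundM_ge4 M4 Mn; split=> [|e expG]; first exact: grig_quo_pgroup.
have e1 : (1 < e)%N.
  have [x] := @grig_quo_sqr_neq1 w n ltac:(lia).
  apply: contraNltn => e1; apply/eqP/(exponentP _ _); last exact: in_setT.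
  by rewrite expG (@dvdn_exp2l 2 e 1).
apply: gen_not_semi_abelian => //; first exact: ltnW.
rewrite (@grig_quo_gen _ _ <<_>>%G) => [|g gG]; first exact: subxx.
apply: mem_gen; rewrite !inE /= -(subnK e1).
have g2 : quo_pi n g ^+ 2 = 1.
  rewrite -quo_piX; apply/quo_pi_eq1P => v _.
  by rewrite gmulfXn (grig_gens_sqr gG).
by rewrite addn2 /= expnS expgM g2 expg1n.
Qed.
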